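(* Let $[a,b]$ be a compact real interval with $a<b$, let $n\in\mathbb{N}_0$, let $s=(s_k)_{k=0}^{2n}$ be the sequence of the truncated moment problem on $[a,b]$, and let $z\in\mathbb{C}$ with $\operatorname{Im}z>0$. For $t\in[0,\infty]$ put $$w_1(t)=-\frac{(-1)^nC_n(z,a)t+C_n(z,b)}{(-1)^nD_n(z,a)t+D_n(z,b)},$$ $$w_2(t)=-\frac{(z-b)(-1)^nC_n(z,a)t+(z-a)C_n(z,b)}{(z-b)(-1)^nD_n(z,a)t+(z-a)D_n(z,b)}.$$ Then the circle $K_1(z)$ corresponding to $w_1$ has center $m_1$ and radius $r_1$, and the circle $K_2(z)$ corresponding to $w_2$ has center $m_2$ and radius $r_2$, given by $$m_1=-\frac{C_n(z,\overline z)}{D_n(z,\overline z)},\qquad r_1=\frac{1}{|D_n(z,\overline z)|},$$ $$m_2=-\frac{\begin{vmatrix}(z-b)C_n(z,a)&(z-a)C_n(z,b)\\ (\overline z-b)D_n(\overline z,a)&(\overline z-a)D_n(\overline z,b)\end{vmatrix}}{\begin{vmatrix}(z-b)D_n(z,a)&(z-a)D_n(z,b)\\ (\overline z-b)D_n(\overline z,a)&(\overline z-a)D_n(\overline z,b)\end{vmatrix}},$$ $$r_2=\left|\frac{(z-a)(z-b)D_n(a,b)}{\begin{vmatrix}(z-b)D_n(z,a)&(z-a)D_n(z,b)\\ (\overline z-b)D_n(\overline z,a)&(\overline z-a)D_n(\overline z,b)\end{vmatrix}}\right|.$$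
   Context: The truncated moment problem for $s=(s_k)_{k=0}^{2n}$ on $[a,b]$ asks for positive measures $\mu$ on $[a,b]$ with $s_k=\int_a^b x^k\,d\mu(x)$ for $k=0,\dots,2n$. The sequence $s$ is a real positive semi-definite moment sequence; $L_s$ is the linear functional with $L_s(x^k)=s_k$, and $\langle p,q\rangle_s=L_s(p\overline q)$ is the induced scalar product. Gram–Schmidt orthonormalization of the monomials $1,x,x^2,\dots$ with respect to it gives the orthonormal polynomials of first kind $P_k$, and the polynomials of second kind are $Q_k(z)=L_{s,x}\left(\frac{P_k(z)-P_k(x)}{z-x}\right)$, where $L_{s,x}$ means that $L_s$ acts on $x$ and $z$ is treated as a constant. For $z,w\in\mathbb{C}$, $$C_n(z,w)=1+(z-w)\sum_{k=0}^nQ_k(z)P_k(w),\qquad D_n(z,w)=(z-w)\sum_{k=0}^nP_k(z)P_k(w).$$ For fixed $z$ with $\operatorname{Im}z>0$, as $\mu$ ranges over the solutions of this moment problem, the points $\int_a^b\frac{d\mu(t)}{t-z}$ fill a closed region in the upper half plane bounded by a pair of circular arcs, which are parametrized by $w_1$ and $w_2$ with $t\in[0,\infty]$. The circle corresponding to $w_i$ is the circle whose boundary contains the arc parametrized by $w_i$. Vertical bars around a $2\times2$ array denote the determinant; around a number, the modulus.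
   Formalization: K_2 is claimed for n≥1 only: for n=0 the determinant in m_2, r_2 is 0 and w_2 lies on a line (this is proved instead). That the circle is the only one containing the arc is claimed when the moment problem has more than one solution; P_0,…,P_n are assumed to exist (s positive definite to degree n). *)

(* Defs.v *)
From HB Require Import structures.
From mathcomp Require Import all_boot all_order all_algebra.
From mathcomp Require Import complex.
From mathcomp Require Import all_classical all_reals all_analysis.

Set Implicit Arguments.
Unset Strict Implicit.
Unset Printing Implicit Defensive.

Import Order.TTheory GRing.Theory Num.Theory.
Import numFieldNormedType.Exports.

Local Open Scope ring_scope.
Local Open Scope complex_scope.

(* A truncated sequence (s_k)_{0 <= k <= 2n} is represented by s : nat -> R;
   values s k with k > 2n are irrelevant: below, [Lfun s] is applied only to
   polynomials of degree at most 2n. *)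

(* mu is a positive measure on [a, b], extended by zero to R, with moments
   s_0, ..., s_2n. *)
Definition solves_moment_problem (R : realType) (a b : R) (n : nat)
    (s : nat -> R) (mu : {measure set (measurableTypeR R) -> \bar R}) : Prop :=
  mu (~` `[a, b]%classic)%classic = 0%E /\
  forall k : nat, (k <= 2 * n)%N ->
    (\int[mu]_(x in `[a, b]%classic) (x ^+ k)%:E = (s k)%:E)%E.

Definition indeterminate_moment_problem (R : realType) (a b : R) (n : nat)
    (s : nat -> R) : Prop :=
  exists mu nu : {measure set (measurableTypeR R) -> \bar R},
    [/\ solves_moment_problem a b n s mu,
        solves_moment_problem a b n s nu &
        exists A : set (measurableTypeR R), measurable A /\ mu A <> nu A].

Section OrthogonalPolynomials.
Variables (R : realType) (s : nat -> R).
Implicit Types (p q : {poly R[i]}) (z w : R[i]).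

Definition Lfun p : R[i] := \sum_(k < size p) p`_k * (s k)%:C.

(* The conjugate is taken on coefficients, the variable being real. *)
Definition inner p q : R[i] := Lfun (p * map_poly Num.conj q).

Definition positive_definite_upto (n : nat) : Prop :=
  forall p, p != 0 -> (size p <= n.+1)%N -> 0 < inner p p.

(* [:: P_0; ...; P_(m-1)] *)
Fixpoint gram_schmidt (m : nat) : seq {poly R[i]} :=
  if m is k.+1 then
    let ps := gram_schmidt k in
    let q := 'X^k - \sum_(p <- ps) inner 'X^k p *: p in
    rcons ps ((sqrtC (inner q q))^-1 *: q)
  else [::].

Definition Ppoly (k : nat) : {poly R[i]} := (gram_schmidt k.+1)`_k.

(* The difference quotient is an exact quotient of polynomials in x. *)
Definition Qfun (k : nat) z : R[i] :=
  Lfun (((Ppoly k).[z]%:P - Ppoly k) %/ (z%:P - 'X)).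

Definition Cfun (n : nat) z w : R[i] :=
  1 + (z - w) * \sum_(k < n.+1) Qfun k z * (Ppoly k).[w].

Definition Dfun (n : nat) z w : R[i] :=
  (z - w) * \sum_(k < n.+1) (Ppoly k).[z] * (Ppoly k).[w].

End OrthogonalPolynomials.

Definition det2 (K : comNzRingType) (x11 x12 x21 x22 : K) : K :=
  \det (block_mx x11%:M x12%:M x21%:M x22%:M : 'M[K]_(1 + 1)).

(* t |-> (A t + B) / (C t + D), with value A / C at t = +oo; only used for
   0 <= t <= +oo. *)
Definition moebius (R : realType) (A B C D : R[i]) (t : \bar R) : R[i] :=
  if t is r%:E then (A * r%:C + B) / (C * r%:C + D) else A / C.

Section Arcs.
Variables (R : realType) (s : nat -> R) (n : nat) (a b : R) (z : R[i]).
Local Notation Ca := (Cfun s n z a%:C).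
Local Notation Cb := (Cfun s n z b%:C).
Local Notation Da := (Dfun s n z a%:C).
Local Notation Db := (Dfun s n z b%:C).

Definition w1 (t : \bar R) : R[i] :=
  - moebius ((-1) ^+ n * Ca) Cb ((-1) ^+ n * Da) Db t.

Definition w2 (t : \bar R) : R[i] :=
  - moebius ((z - b%:C) * (-1) ^+ n * Ca) ((z - a%:C) * Cb)
            ((z - b%:C) * (-1) ^+ n * Da) ((z - a%:C) * Db) t.

Local Notation zb := (Num.conj z).

Definition m1 : R[i] := - (Cfun s n z zb / Dfun s n z zb).

Definition r1 : R[i] := 1 / `|Dfun s n z zb|.

Definition den2 : R[i] :=
  det2 ((z - b%:C) * Da) ((z - a%:C) * Db)
       ((zb - b%:C) * Dfun s n zb a%:C) ((zb - a%:C) * Dfun s n zb b%:C).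

Definition m2 : R[i] :=
  - (det2 ((z - b%:C) * Ca) ((z - a%:C) * Cb)
          ((zb - b%:C) * Dfun s n zb a%:C) ((zb - a%:C) * Dfun s n zb b%:C)
     / den2).

Definition r2 : R[i] :=
  `|(z - a%:C) * (z - b%:C) * Dfun s n a%:C b%:C / den2|.

End Arcs.

Definition arc_on_circle (R : realType) (w : \bar R -> R[i]) (m r : R[i]) : Prop :=
  forall t : \bar R, (0 <= t)%E -> `|w t - m| = r.

Definition only_circle_through_arc (R : realType) (w : \bar R -> R[i])
    (m r : R[i]) : Prop :=
  forall m' r' : R[i], arc_on_circle w m' r' -> m' = m /\ r' = r.

Definition arc_on_line (R : realType) (w : \bar R -> R[i]) : Prop :=
  exists p d : R[i], d != 0 /\
    forall t : \bar R, (0 <= t)%E -> exists x : R, w t = p + x%:C * d.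

(* Main.v *)
(** The polynomials C(z, .) and D(z, .) have degree at most n + 1 and are
    orthogonal to all polynomials of degree below n, so modulo their leading
    coefficients they are determined up to a multiple of P_n.  Since P_n(a) <> 0
    this yields
      P_n(a) D(z, w) = D(z, a) P_n(w) + P_n(z) D(a, w),
      P_n(a) C(z, w) = C(z, a) P_n(w) + Q_n(z) D(a, w),
    and C(z, z) = 1 then gives C(z, a) D(z, b) - C(z, b) D(z, a) = D(a, b).
    Hence w1 and w2 are images of real lines under Moebius maps whose poles are
    not real, and centre and radius follow from the elementary formula for such
    an image.  Positivity of the functional on polynomials nonnegative on [a, b]
    puts the zeros of P_n in (a, b), so that the denominators do not vanish on
    the arc, and shows that K(z, a) / K(z, b) is not real when n > 0, so that
    the circle K_2 is proper.  An arc fails to determine its circle only if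
    D(a, b) = 0, in which case the solution is unique. *)

From HB Require Import structures.
Require Import Defs.
From mathcomp Require Import all_boot all_order all_algebra.
From mathcomp Require Import complex.
From mathcomp Require Import all_classical all_reals all_analysis.
From mathcomp Require Import measurable_realfun.
From mathcomp Require Import ring lra zify.

Set Implicit Arguments.
Unset Strict Implicit.
Unset Printing Implicit Defensive.

Import Order.TTheory GRing.Theory Num.Theory.
Local Open Scope ring_scope.
Local Open Scope complex_scope.

(** * The moment functional, its orthonormal polynomials and the two kernels *)

Section MomentFunctional.
Context {R : realType}.
Variable (s : nat -> R).
Implicit Types (p q f r : {poly R[i]}) (z w : R[i]).
Local Notation L := (Defs.Lfun s).
Local Notation conjp := (map_poly Num.conj).

Lemma Lfun_widen N p : (size p <= N)%N -> L p = \sum_(k < N) p`_k * (s k)%:C.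
Proof.
move=> le_pN; rewrite /Defs.Lfun (big_ord_widen N (fun k => p`_k * (s k)%:C)) //.
rewrite big_mkcond; apply: eq_bigr => k _.
by case: ltnP => // le_pk; rewrite nth_default ?mul0r.
Qed.

Lemma Lfun_is_scalar : scalar L.
Proof.
move=> c p q; set N := maxn (size p) (size q).
have le_pN : (size p <= N)%N by apply: leq_maxl.
have le_qN : (size q <= N)%N by apply: leq_maxr.
have le_N : (size (c *: p + q)%R <= N)%N.
  by rewrite (leq_trans (size_polyD _ _)) // geq_max le_qN (leq_trans (size_scale_leq _ _)).
rewrite (Lfun_widen le_pN) (Lfun_widen le_qN) (Lfun_widen le_N) mulr_sumr -big_split /=.
by apply: eq_bigr => k _; rewrite coefD coefZ mulrDl mulrA.
Qed.

HB.instance Definition _ :=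
  GRing.isLinear.Build R[i] {poly R[i]} R[i] _ L Lfun_is_scalar.

Lemma conj_real_complex (x : R) : Num.conj (x%:C : R[i]) = x%:C.
Proof. exact: conjc_real. Qed.

Lemma Lfun_conj p : L (conjp p) = Num.conj (L p).
Proof.
rewrite (@Lfun_widen (size p)) ?size_poly // rmorph_sum.
by apply: eq_bigr => k _; rewrite coef_map rmorphM /= conj_real_complex.
Qed.

Lemma horner_conjp p z : (conjp p).[z] = Num.conj p.[Num.conj z].
Proof. by rewrite -{1}[z]conjCK horner_map. Qed.

Lemma inner_real p q : conjp q = q -> inner s p q = L (p * q).
Proof. by rewrite /inner => ->. Qed.

Lemma gram_schmidtE m : gram_schmidt s m = mkseq (Ppoly s) m.
Proof.
elim: m => // m IHm; rewrite mkseqS -IHm /Ppoly /=.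
by rewrite nth_rcons IHm size_mkseq ltnn eqxx.
Qed.

(** The unnormalised Gram-Schmidt vector, with a sum over indices in place of the list fold so that
    orthogonality can be applied termwise. *)
Definition gram_residual (k : nat) : {poly R[i]} :=
  'X^k - \sum_(j < k) inner s 'X^k (Ppoly s j) *: Ppoly s j.

Lemma PpolyE k : Ppoly s k =
  (sqrtC (inner s (gram_residual k) (gram_residual k)))^-1 *: gram_residual k.
Proof.
rewrite {1}/Ppoly /= nth_rcons gram_schmidtE size_mkseq ltnn eqxx.
suff -> : \sum_(p <- mkseq (Ppoly s) k) inner s 'X^k p *: p =
          \sum_(j < k) inner s 'X^k (Ppoly s j) *: Ppoly s j by [].
by rewrite big_map
   -(big_mkord xpredT (fun j => inner s 'X^k (Ppoly s j) *: Ppoly s j)) /index_iota subn0.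
Qed.

Section Orthonormality.
Variables (n : nat) (pos_s : positive_definite_upto s n).

(** The three claims need one joint induction: real coefficients of the earlier [Ppoly s j] turn
    [inner] into the bilinear L(pq), their orthonormality makes the residual orthogonal to them, and
    their sizes keep the residual of degree k, hence nonzero and of positive norm. *)
Lemma Ppoly_spec k : (k <= n)%N ->
  [/\ size (Ppoly s k) = k.+1, conjp (Ppoly s k) = Ppoly s k &
      forall j, (j <= k)%N -> L (Ppoly s k * Ppoly s j) = (j == k)%:R].
Proof.
elim/ltn_ind: k => k IHk le_kn.
have{}IHk j : (j < k)%N -> _ := fun lt_jk => IHk j lt_jk (leq_trans (ltnW lt_jk) le_kn).
have orth_lt i j : (i < k)%N -> (j < k)%N ->
    L (Ppoly s i * Ppoly s j) = (i == j)%:R.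
  move=> lt_ik lt_jk; have [le_ij|/ltnW le_ji] := leqP i j.
    by rewrite mulrC; have [_ _ ->] := IHk j lt_jk.
  by have [_ _ ->] := IHk i lt_ik; rewrite // eq_sym.
pose q := gram_residual k.
have size_q : size q = k.+1.
  rewrite /q /gram_residual size_polyDl ?size_polyXn // size_polyN ltnS.
  apply: (leq_trans (size_sum _ _ _)); apply/bigmax_leqP => j _.
  by have [size_P _ _] := IHk j (ltn_ord j);
     rewrite (leq_trans (size_scale_leq _ _)) // size_P.
have conj_q : conjp q = q.
  rewrite /q /gram_residual rmorphB /= map_polyXn rmorph_sum /=; congr (_ - _).
  apply: eq_bigr => j _; have [_ conjP _] := IHk j (ltn_ord j).
  by rewrite map_polyZ /= conjP inner_real // -Lfun_conj rmorphM /= map_polyXn conjP.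
have q_P j : (j < k)%N -> L (q * Ppoly s j) = 0.
  move=> lt_jk; rewrite /q /gram_residual mulrBl linearB /= mulr_suml.
  rewrite [L (\sum_(_ < k) _)]linear_sum /=.
  apply/eqP; rewrite subr_eq0 eq_sym; apply/eqP.
  (* Only the j-th projection survives against P_j, and it cancels L(X^k P_j). *)
  have LE (i : 'I_k) : L (inner s 'X^k (Ppoly s i) *: Ppoly s i * Ppoly s j) =
      if i == Ordinal lt_jk then L ('X^k * Ppoly s j) else 0.
    rewrite -scalerAl linearZ /= orth_lt // -val_eqE /=; case: eqP => [->|_].
      by have [_ conjP _] := IHk j lt_jk; rewrite mulr1 inner_real.
    by rewrite mulr0.
  by rewrite (eq_bigr _ (fun i _ => LE i)) -big_mkcond big_pred1_eq.
have q_gt0 : 0 < inner s q q.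
  by apply: pos_s; rewrite ?size_q // -size_poly_eq0 size_q.
set c := (sqrtC (inner s q q))^-1.
have PE : Ppoly s k = c *: q by exact: PpolyE.
have c_gt0 : 0 < c by rewrite invr_gt0 sqrtC_gt0.
have conj_c : Num.conj c = c by apply: conj_Creal; rewrite gtr0_real.
have Lqq : L (q * q) = inner s q q by rewrite inner_real.
split=> [||j].
- by rewrite PE size_scale // gt_eqF.
- by rewrite PE map_polyZ /= conj_q conj_c.
rewrite leq_eqVlt => /predU1P[-> | lt_jk].
  rewrite PE eqxx -scalerAl -scalerAr !linearZ /= Lqq -[X in c * (c * X)](sqrtCK (inner s q q)).
  by rewrite mulrA -expr2 -exprMn mulVf ?expr1n // gt_eqF // sqrtC_gt0.
by rewrite PE -scalerAl linearZ /= q_P // mulr0 ltn_eqF.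
Qed.

Lemma size_Ppoly k : (k <= n)%N -> size (Ppoly s k) = k.+1.
Proof. by case/Ppoly_spec. Qed.

Lemma Ppoly0_const : exists2 c : R[i], c != 0 & Ppoly s 0 = c%:P.
Proof.
have size_P0 := size_Ppoly (leq0n n).
exists (Ppoly s 0)`_0; last by apply: size1_polyC; rewrite size_P0.
have := lead_coef_eq0 (Ppoly s 0); rewrite lead_coefE size_P0 /= => ->.
by rewrite -size_poly_eq0 size_P0.
Qed.

Lemma conj_Ppoly k : (k <= n)%N -> conjp (Ppoly s k) = Ppoly s k.
Proof. by case/Ppoly_spec. Qed.

Lemma horner_Ppoly_conj k z : (k <= n)%N ->
  (Ppoly s k).[Num.conj z] = Num.conj (Ppoly s k).[z].
Proof. by move=> le_kn; rewrite -{1}conj_Ppoly // horner_conjp conjCK. Qed.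

Lemma Ppoly_orthonormal i j : (i <= n)%N -> (j <= n)%N ->
  L (Ppoly s i * Ppoly s j) = (i == j)%:R.
Proof.
move=> le_in le_jn; have [le_ij|/ltnW le_ji] := leqP i j.
  by rewrite mulrC; have [_ _ ->] := Ppoly_spec le_jn.
by have [_ _ ->] := Ppoly_spec le_in; rewrite // eq_sym.
Qed.

Lemma Ppoly_span m f : (m <= n.+1)%N -> (size f <= m)%N ->
  exists c : nat -> R[i], f = \sum_(k < m) c k *: Ppoly s k.
Proof.
elim: m f => [|m IHm] f le_mn size_f.
  by exists (fun=> 0); rewrite big_ord0; apply/eqP; rewrite -size_poly_leq0.
have size_P := size_Ppoly le_mn.
have lc_P : (Ppoly s m)`_m != 0.
  by have := lead_coef_eq0 (Ppoly s m); rewrite lead_coefE size_P /= => ->;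
     rewrite -size_poly_eq0 size_P.
pose d := f`_m / (Ppoly s m)`_m.
have [|c fE] := IHm (f - d *: Ppoly s m) (ltnW le_mn).
  apply/leq_sizeP => j; rewrite leq_eqVlt => /predU1P[<- | lt_mj].
    by rewrite coefB coefZ divfK ?subrr.
  by rewrite coefB coefZ [f`_j]nth_default ?[(Ppoly s m)`_j]nth_default
    ?mulr0 ?subrr ?size_P // (leq_trans size_f).
exists (fun k => if k == m then d else c k).
rewrite big_ord_recr /= eqxx -[LHS](subrK (d *: Ppoly s m)) fE; congr (_ + _).
by apply: eq_bigr => k _; rewrite (ltn_eqF (ltn_ord k)).
Qed.

Lemma Fourier_expansion f : (size f <= n.+1)%N ->
  f = \sum_(k < n.+1) L (f * Ppoly s k) *: Ppoly s k.
Proof.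
move=> size_f; have [c fE] := Ppoly_span (leqnn _) size_f.
rewrite {1}fE; apply: eq_bigr => k _; congr (_ *: _).
have le_n (i : 'I_n.+1) : (i <= n)%N by rewrite -ltnS.
rewrite fE mulr_suml linear_sum (bigD1 k) //= big1 => [|i ne_ik];
  rewrite -scalerAl linearZ /= Ppoly_orthonormal //.
  by rewrite eqxx mulr1 addr0.
by rewrite (negPf (_ : val i != val k)) ?mulr0.
Qed.

(** The Christoffel-Darboux kernel K(z, .), as a polynomial in its second argument. *)
Definition kernel_poly z : {poly R[i]} :=
  \sum_(k < n.+1) (Ppoly s k).[z] *: Ppoly s k.

(** The analogue with Q_k(z) for P_k(z): it represents the functional sending f to L of its
    difference quotient at z. *)
Definition kernel2_poly z : {poly R[i]} :=
  \sum_(k < n.+1) Qfun s k z *: Ppoly s k.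

Lemma size_Ppoly_comb (c : nat -> R[i]) :
  (size (\sum_(k < n.+1) c k *: Ppoly s k)%R <= n.+1)%N.
Proof.
apply: (leq_trans (size_sum _ _ _)); apply/bigmax_leqP => k _.
by rewrite (leq_trans (size_scale_leq _ _)) // size_Ppoly // -ltnS.
Qed.

Lemma coef_Ppoly_comb (c : nat -> R[i]) :
  (\sum_(k < n.+1) c k *: Ppoly s k)`_n = c n * (Ppoly s n)`_n.
Proof.
rewrite coef_sum big_ord_recr /= coefZ big1 ?add0r // => k _.
rewrite coefZ [_`_n]nth_default ?mulr0 // size_Ppoly //.
exact: ltnW.
Qed.

Lemma DfunE z w : Dfun s n z w = ((z%:P - 'X) * kernel_poly z).[w].
Proof.
rewrite hornerM hornerD hornerN hornerX hornerC horner_sum /Dfun.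
by congr (_ * _); apply: eq_bigr => k _; rewrite hornerZ.
Qed.

Lemma CfunE z w : Cfun s n z w = (1 + (z%:P - 'X) * kernel2_poly z).[w].
Proof.
rewrite hornerD hornerM hornerD hornerN hornerX !hornerC horner_sum /Cfun.
by congr (_ + _ * _); apply: eq_bigr => k _; rewrite hornerZ.
Qed.

Lemma kernel_poly_reproducing z f : (size f <= n.+1)%N ->
  L (kernel_poly z * f) = f.[z].
Proof.
move=> /Fourier_expansion {2}->; rewrite mulr_suml linear_sum horner_sum.
apply: eq_bigr => k _.
by rewrite -scalerAl linearZ /= hornerZ mulrC [Ppoly s k * f]mulrC.
Qed.

Definition difference_quotient z p : {poly R[i]} := (p.[z]%:P - p) %/ (z%:P - 'X).

Lemma difference_quotient_comb z (c : nat -> R[i]) m :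
  difference_quotient z (\sum_(k < m) c k *: Ppoly s k) =
  \sum_(k < m) c k *: difference_quotient z (Ppoly s k).
Proof.
elim: m => [|m IHm]; first by rewrite !big_ord0 /difference_quotient horner0 subrr div0p.
rewrite !big_ord_recr /= -IHm /difference_quotient -divpZl -divpD hornerD hornerZ; congr (_ %/ _).
by rewrite scalerBr -!mul_polyC polyCD polyCM; ring.
Qed.

(** On each P_k this is the definition of Q_k(z); the difference quotient is linear in the
    polynomial, so the Fourier expansion of f gives the rest. *)
Lemma kernel2_poly_reproducing z f : (size f <= n.+1)%N ->
  L (kernel2_poly z * f) = L (difference_quotient z f).
Proof.
move=> size_f; rewrite [in RHS](Fourier_expansion size_f).
rewrite (difference_quotient_comb z (fun k => L (f * Ppoly s k))) mulr_suml !linear_sum.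
apply: eq_bigr => k _.
by rewrite -scalerAl !linearZ /= mulrC [Ppoly s k * f]mulrC.
Qed.

End Orthonormality.
End MomentFunctional.

(** * Expansions and determinant identities for C and D *)

Section KernelIdentities.
Context {R : realType}.
Variables (s : nat -> R) (n : nat) (pos_s : positive_definite_upto s n).
Implicit Types (p q f g r : {poly R[i]}) (z w y : R[i]).
Local Notation L := (Defs.Lfun s).
Local Notation P := (Ppoly s).
Local Notation C := (Cfun s n).
Local Notation D := (Dfun s n).

Lemma orthogonal_lower_degree f : (size f <= n.+1)%N ->
  (forall r, (size r <= n)%N -> L (f * r) = 0) -> f = L (f * P n) *: P n.
Proof.
move=> /(Fourier_expansion pos_s) {2}-> orth_f.
rewrite big_ord_recr /= big1 ?add0r // => k _.
by rewrite orth_f ?scale0r // (size_Ppoly pos_s) // ltnW.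
Qed.

Lemma coef_linear_factor z p m :
  ((z%:P - 'X) * p)`_m.+1 = z * p`_m.+1 - p`_m.
Proof. by rewrite mulrBl coefB coefCM coefXM. Qed.

Lemma size_linear_factor z p m : (size p <= m)%N -> (size ((z%:P - 'X) * p)%R <= m.+1)%N.
Proof.
move=> le_pm; apply/leq_sizeP => -[//|j] lt_mj.
by rewrite coef_linear_factor !nth_default ?mulr0 ?subrr // (leq_trans le_pm) // ltnW.
Qed.

(** The polynomial (z - X) r has degree at most n and vanishes at z, so the reproducing property
    returns 0. *)
Lemma kernel_factor_orthogonal z r : (size r <= n)%N ->
  L ((z%:P - 'X) * kernel_poly s n z * r) = 0.
Proof.
move=> size_r; rewrite mulrAC mulrC (kernel_poly_reproducing pos_s) ?size_linear_factor //.
by rewrite hornerM hornerD hornerN hornerX hornerC subrr mul0r.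
Qed.

(** Since (z - X) r vanishes at z, its difference quotient is -r, which cancels the contribution of
    the summand 1. *)
Lemma kernel2_factor_orthogonal z r : (size r <= n)%N ->
  L ((1 + (z%:P - 'X) * kernel2_poly s n z) * r) = 0.
Proof.
move=> size_r; rewrite mulrDl mul1r mulrAC mulrC linearD /= mulrC.
rewrite (mulrC _ (kernel2_poly s n z)) (kernel2_poly_reproducing pos_s) ?size_linear_factor //.
rewrite /difference_quotient hornerM hornerD hornerN hornerX hornerC subrr mul0r polyC0 sub0r.
rewrite -mulrN mulrC mulpK ?linearN /= ?subrr //.
by rewrite -opprB oppr_eq0 polyXsubC_eq0.
Qed.

(* A polynomial of degree at most n orthogonal to all degrees below n is a
   multiple of P_n; the multiple is read off at y. *)
Lemma vanishing_leading_coef (c d : R[i]) f g y :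
  (size f <= n.+2)%N -> (size g <= n.+2)%N -> c * f`_n.+1 = d * g`_n.+1 ->
  (forall r, (size r <= n)%N -> L (f * r) = 0) ->
  (forall r, (size r <= n)%N -> L (g * r) = 0) ->
  (P n).[y] != 0 -> forall w,
  (P n).[y] * (c * f.[w] - d * g.[w]) = (c * f.[y] - d * g.[y]) * (P n).[w].
Proof.
move=> size_f size_g eq_lead orth_f orth_g Py w.
set h := c *: f - d *: g.
have hE x : h.[x] = c * f.[x] - d * g.[x] by rewrite /h hornerD hornerN !hornerZ.
have size_h : (size h <= n.+1)%N.
  apply/leq_sizeP => j; rewrite leq_eqVlt coefB !coefZ => /predU1P[<- | lt_nj].
    by rewrite eq_lead; apply: subrr.
  by rewrite !nth_default ?mulr0 ?subrr // (leq_trans _ lt_nj).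
have orth_h r : (size r <= n)%N -> L (h * r) = 0.
  move=> size_r; rewrite /h mulrBl linearB /= -!scalerAl linearZ [L (d *: _)]linearZ /=.
  by rewrite orth_f // orth_g // !mulr0 subrr.
by rewrite -!hE (orthogonal_lower_degree size_h orth_h) !hornerZ; ring.
Qed.

Lemma size_kernel_factor z :
  (size ((z%:P - 'X) * kernel_poly s n z)%R <= n.+2)%N.
Proof. by apply/size_linear_factor/(size_Ppoly_comb pos_s (fun k => (P k).[z])). Qed.

Lemma coef_kernel_factor z :
  ((z%:P - 'X) * kernel_poly s n z)`_n.+1 = - ((P n).[z] * (P n)`_n).
Proof.
rewrite coef_linear_factor (coef_Ppoly_comb pos_s (fun k => (P k).[z])).
rewrite nth_default ?mulr0 ?sub0r //.
exact: (size_Ppoly_comb pos_s (fun k => (P k).[z])).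
Qed.

Lemma size_kernel2_factor z :
  (size (1 + (z%:P - 'X) * kernel2_poly s n z)%R <= n.+2)%N.
Proof.
rewrite (leq_trans (size_polyD _ _)) // geq_max size_poly1 /=.
by apply/size_linear_factor/(size_Ppoly_comb pos_s (fun k => Qfun s k z)).
Qed.

Lemma coef_kernel2_factor z :
  (1 + (z%:P - 'X) * kernel2_poly s n z)`_n.+1 = - (Qfun s n z * (P n)`_n).
Proof.
rewrite coefD coef1 add0r coef_linear_factor.
rewrite (coef_Ppoly_comb pos_s (fun k => Qfun s k z)) nth_default ?mulr0 ?sub0r //.
exact: (size_Ppoly_comb pos_s (fun k => Qfun s k z)).
Qed.

(** The leading coefficients of D(z, .) and D(y, .) are in the ratio P_n(z) : P_n(y), so P_n(y) D(z,
    .) - P_n(z) D(y, .) is a multiple of P_n; evaluation at y, where D(y, y) = 0, finds the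
    multiple. *)
Lemma Dfun_expansion y z w : (P n).[y] != 0 ->
  (P n).[y] * D z w = D z y * (P n).[w] + (P n).[z] * D y w.
Proof.
move=> Py.
have := @vanishing_leading_coef (P n).[y] (P n).[z] _ _ y
  (size_kernel_factor z) (size_kernel_factor y) _
  (@kernel_factor_orthogonal z) (@kernel_factor_orthogonal y) Py w.
rewrite !coef_kernel_factor -!DfunE // [D y y]/Dfun subrr mul0r mulr0 subr0 => E.
have /(mulfI Py) : (P n).[y] * ((P n).[y] * D z w - (P n).[z] * D y w) =
    (P n).[y] * (D z y * (P n).[w]) by rewrite E ?mulrA //; ring.
by move/(canRL (subrK _)).
Qed.

Lemma Cfun_expansion y z w : (P n).[y] != 0 ->
  (P n).[y] * C z w = C z y * (P n).[w] + Qfun s n z * D y w.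
Proof.
move=> Py.
have := @vanishing_leading_coef (P n).[y] (Qfun s n z) _ _ y
  (size_kernel2_factor z) (size_kernel_factor y) _
  (@kernel2_factor_orthogonal z) (@kernel_factor_orthogonal y) Py w.
rewrite coef_kernel_factor coef_kernel2_factor -!DfunE // -!CfunE //.
rewrite [D y y]/Dfun subrr mul0r mulr0 subr0 => E.
have /(mulfI Py) : (P n).[y] * ((P n).[y] * C z w - Qfun s n z * D y w) =
    (P n).[y] * (C z y * (P n).[w]) by rewrite E ?mulrA //; ring.
by move/(canRL (subrK _)).
Qed.

Lemma Dfun_antisym z w : D z w = - D w z.
Proof.
rewrite /Dfun -mulNr opprB; congr (_ * _).
by apply: eq_bigr => k _; rewrite mulrC.
Qed.

Lemma Cfun_diag z : C z z = 1.
Proof. by rewrite /Cfun subrr mul0r addr0. Qed.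

(** The expansion of C at w = z, where C(z, z) = 1. *)
Lemma Cfun_Dfun_Wronskian y z : (P n).[y] != 0 ->
  C z y * (P n).[z] - Qfun s n z * D z y = (P n).[y].
Proof.
by move=> Py; rewrite [D z y]Dfun_antisym mulrN opprK -Cfun_expansion // Cfun_diag mulr1.
Qed.

(** After multiplication by P_n(y) both expansions apply; the terms with P_n(w) cancel, and D(y, w)
    is left with the Wronskian as its factor. *)
Lemma Cfun_Dfun_det y z w : (P n).[y] != 0 ->
  C z y * D z w - C z w * D z y = D y w.
Proof.
move=> Py; apply: (mulfI Py).
have -> : (P n).[y] * (C z y * D z w - C z w * D z y) =
  C z y * ((P n).[y] * D z w) - (P n).[y] * C z w * D z y by ring.
rewrite Dfun_expansion // Cfun_expansion // -[in RHS](Cfun_Dfun_Wronskian z Py).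
by ring.
Qed.

Lemma Dfun_conj z w : D (Num.conj z) (Num.conj w) = Num.conj (D z w).
Proof.
rewrite /Dfun rmorphM rmorphB rmorph_sum; congr (_ * _).
by apply: eq_bigr => k _; rewrite rmorphM /= !(horner_Ppoly_conj pos_s) // -ltnS.
Qed.

Lemma Dfun_conj_real z (x : R) : D (Num.conj z) x%:C = Num.conj (D z x%:C).
Proof. by rewrite -Dfun_conj conj_real_complex. Qed.

Lemma Im_neq0_conj z : complex.Im z != 0 -> z - Num.conj z != 0.
Proof.
move=> Im_z; rewrite subr_eq0; apply: contra Im_z => /eqP /(congr1 (@complex.Im R)).
by case: z => x y /= /eqP; rewrite -addr_eq0 -mulr2n mulrn_eq0.
Qed.

(** The sum becomes that of |P_k(z)|^2, whose k = 0 term is positive because P_0 is a nonzero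
    constant. *)
Lemma Dfun_diag_neq0 z : complex.Im z != 0 -> D z (Num.conj z) != 0.
Proof.
move=> Im_z; rewrite mulf_neq0 ?Im_neq0_conj // gt_eqF //.
have normP (k : 'I_n.+1) : (P k).[z] * (P k).[Num.conj z] = `|(P k).[z]| ^+ 2.
  by rewrite (horner_Ppoly_conj pos_s) -?normCK // -ltnS.
rewrite (eq_bigr _ (fun k _ => normP k)) big_ord_recl ltr_pwDl //.
  have [c c0 ->] := Ppoly0_const pos_s.
  by rewrite hornerC exprn_gt0 // normr_gt0.
by apply: sumr_ge0 => k _; rewrite exprn_ge0.
Qed.

End KernelIdentities.

(** * Consequences of positivity on [a, b]: zeros of P_n and independence of the endpoint kernels *)

Section NonnegativeFunctional.
Context {R : realType}.
Variables (s : nat -> R) (n : nat) (pos_s : positive_definite_upto s n).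
Variables (a b : R) (lt_ab : a < b).
Implicit Types (p q f g h r : {poly R[i]}) (z w y : R[i]).
Local Notation L := (Defs.Lfun s).
Local Notation conjp := (map_poly Num.conj).
Local Notation P := (Ppoly s).
Local Notation D := (Dfun s n).

(** The trace of a representing measure used in this section; [solution_nonneg] supplies it. *)
Hypothesis nonneg_s : forall p, (size p <= n.*2.+1)%N ->
  (forall x : R, a <= x <= b -> 0 <= p.[x%:C]) -> 0 <= L p.

Local Notation Xa := ('X - (a%:C)%:P : {poly R[i]}).
Local Notation bX := ((b%:C)%:P - 'X : {poly R[i]}).

Lemma size_conjp p : size (conjp p) = size p.
Proof. exact: size_map_poly. Qed.

Lemma horner_mul_conjp h (x : R) : (h * conjp h).[x%:C] = `|h.[x%:C]| ^+ 2.
Proof. by rewrite hornerM horner_conjp conj_real_complex normCK. Qed.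

Lemma conjp_Xsub (x : R) : conjp ('X - (x%:C)%:P) = 'X - (x%:C)%:P.
Proof. by rewrite rmorphB /= map_polyX map_polyC /= conj_real_complex. Qed.

Lemma conjp_subX (x : R) : conjp ((x%:C)%:P - 'X) = (x%:C)%:P - 'X.
Proof. by rewrite rmorphB /= map_polyX map_polyC /= conj_real_complex. Qed.

Lemma size_subX (x : R[i]) : size (x%:P - 'X) = 2%N.
Proof. by rewrite -opprB size_polyN size_XsubC. Qed.

Lemma Pn_orthogonal r : (size r <= n)%N -> L (P n * r) = 0.
Proof.
move=> size_r; have [c ->] := Ppoly_span pos_s (leqnSn n) size_r.
rewrite mulr_sumr linear_sum big1 // => k _.
rewrite -scalerAr linearZ /= (Ppoly_orthonormal pos_s) ?(ltnW (ltn_ord k)) //.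
by rewrite gtn_eqF ?mulr0.
Qed.

Lemma size_interval_weight_mul p : (size (Xa * bX * p)%R <= (size p).+2)%N.
Proof.
rewrite -mulrA (leq_trans (size_polyMleq _ _)) // size_XsubC ltnS.
by rewrite (leq_trans (size_polyMleq _ _)) // size_subX.
Qed.

(** The weight has degree 2, so h of degree at most n - 1 keeps the product within degree 2n. *)
Lemma interval_weight_ge0 h : (size h <= n)%N -> 0 <= L (Xa * bX * (h * conjp h)).
Proof.
move=> size_h; apply: nonneg_s => [|x /andP[le_ax le_xb]].
  have [->|h_neq0] := eqVneq h 0; first by rewrite mul0r mulr0 size_poly0.
  have := size_interval_weight_mul (h * conjp h); have := size_polyMleq h (conjp h).
  by rewrite size_conjp; move: h_neq0; rewrite -size_poly_gt0; lia.
rewrite hornerM horner_mul_conjp mulr_ge0 ?exprn_ge0 //.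
rewrite hornerM !hornerE mulr_ge0 // -?rmorphB ler0c; lra.
Qed.

(* With P_n = (X - y) h, orthogonality gives L(X |h|^2) = y L(|h|^2), and
   (b - a)(x - a) = (x - a)^2 + (x - a)(b - x) forces y - a > 0. *)
Lemma Pn_root_real y : root (P n) y -> exists2 x : R, y = x%:C & a < x < b.
Proof.
move=> /factor_theorem[h PE].
have size_Pn := size_Ppoly pos_s (leqnn n).
have h_neq0 : h != 0.
  by apply/eqP => h0; move: size_Pn; rewrite PE h0 mul0r size_poly0.
have size_h : size h = n.
  by move: size_Pn; rewrite PE size_Mmonic ?monicXsubC // size_XsubC addn2 => -[].
have M_gt0 : 0 < L (h * conjp h) by apply: pos_s; rewrite ?size_h.
have LX : L ('X * (h * conjp h)) = y * L (h * conjp h).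
  apply/eqP; rewrite -subr_eq0 -linearZ -linearB /= -mul_polyC -mulrBl.
  by rewrite mulrA [_ * h]mulrC -PE Pn_orthogonal // size_conjp size_h.
have LXc (c : R) : L (('X - (c%:C)%:P) * (h * conjp h)) = (y - c%:C) * L (h * conjp h).
  by rewrite !mulrBl linearB /= LX mul_polyC linearZ.
have ba_gt0 : 0 < (b - a)%:C by rewrite ltcR subr_gt0.
have W_ge0 : 0 <= L (Xa * bX * (h * conjp h)) by rewrite interval_weight_ge0 // size_h.
have sq_gt0 (c : R) : 0 < L (('X - (c%:C)%:P) ^+ 2 * (h * conjp h)).
  have -> : ('X - (c%:C)%:P) ^+ 2 * (h * conjp h) =
      ('X - (c%:C)%:P) * h * conjp (('X - (c%:C)%:P) * h).
    by rewrite rmorphM /= conjp_Xsub; ring.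
  apply: pos_s; first by rewrite mulf_neq0 // polyXsubC_eq0.
  by rewrite size_monicM ?monicXsubC // size_XsubC size_h.
have ya_gt0 : 0 < y - a%:C.
  rewrite -(pmulr_lgt0 _ M_gt0) -LXc -(pmulr_rgt0 _ ba_gt0) -linearZ /=.
  have -> : (b - a)%:C *: (Xa * (h * conjp h)) =
      Xa ^+ 2 * (h * conjp h) + Xa * bX * (h * conjp h).
    by rewrite -mul_polyC rmorphB polyCB /=; ring.
  by rewrite linearD /= ltr_pwDl.
(* The mirrored identity (b - a)(b - x) = (b - x)^2 + (x - a)(b - x) bounds y from above. *)
have by_gt0 : 0 < b%:C - y.
  rewrite -opprB -(pmulr_lgt0 _ M_gt0) mulNr -LXc -(pmulr_rgt0 _ ba_gt0) mulrN -linearZ -linearN /=.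
  have -> : - ((b - a)%:C *: (('X - (b%:C)%:P) * (h * conjp h))) =
      ('X - (b%:C)%:P) ^+ 2 * (h * conjp h) + Xa * bX * (h * conjp h).
    by rewrite -mul_polyC rmorphB polyCB /=; ring.
  by rewrite linearD /= ltr_pwDl.
exists (complex.Re y).
  by case: y ya_gt0 {PE LX LXc by_gt0} => x v; rewrite ltcE /= oppr0 addr0 => /andP[/eqP-> _].
move: ya_gt0 by_gt0; rewrite !ltcE /= => /andP[_ +] /andP[_].
by case: (y) => x v /=; rewrite !subr_gt0 => -> ->.
Qed.

(** All n roots y lie in (a, b); the sign turns each a - y into y - a, which leaves the square of a
    real leading coefficient times a product of positive (y - a)(b - y). *)
Lemma Pn_endpoints_sign : 0 < (-1) ^+ n * ((P n).[a%:C] * (P n).[b%:C]).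
Proof.
have [rs PE] := closed_field_poly_normal (P n).
have size_Pn := size_Ppoly pos_s (leqnn n).
have lc_neq0 : lead_coef (P n) != 0 by rewrite lead_coef_eq0 -size_poly_eq0 size_Pn.
have size_rs : size rs = n.
  by move: size_Pn; rewrite PE size_scale // size_prod_XsubC => -[].
have rs_real y : y \in rs -> exists2 x : R, y = x%:C & a < x < b.
  by move=> y_rs; apply: Pn_root_real; rewrite PE rootZ // root_prod_XsubC.
have lc_real : lead_coef (P n) \is Num.real.
  apply/CrealP; rewrite -{2}(conj_Ppoly pos_s (leqnn n)).
  by rewrite lead_coef_map.
have evalE (x : R[i]) : (P n).[x] = lead_coef (P n) * \prod_(y <- rs) (x - y).
  rewrite {1}PE hornerZ horner_prod; congr (_ * _).
  by apply: eq_bigr => y _; rewrite hornerXsubC.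
have -> : (-1) ^+ n * ((P n).[a%:C] * (P n).[b%:C]) =
    lead_coef (P n) ^+ 2 * \prod_(y <- rs) ((y - a%:C) * (b%:C - y)).
  rewrite !evalE -[X in (-1) ^+ X]size_rs.
  have <- : (-1) ^+ size rs * (\prod_(y <- rs) (a%:C - y) * \prod_(y <- rs) (b%:C - y)) =
      \prod_(y <- rs) ((y - a%:C) * (b%:C - y)).
    elim: (rs) => [|y rs' IHrs]; first by rewrite !big_nil !mulr1.
    by rewrite !big_cons -IHrs /= exprS; ring.
  by ring.
rewrite mulr_gt0 ?real_exprn_even_gt0 //.
rewrite big_seq; apply: prodr_gt0 => y /rs_real[x -> /andP[lt_ax lt_xb]].
by rewrite -!rmorphB mulr_gt0 ?ltcR ?subr_gt0.
Qed.

(* If g = c K(a, .) + d K(b, .) vanished at z and its conjugate, then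
   g = (x - z)(x - conj z) h would be orthogonal to (x - a)(b - x) conj h, whereas
   (x - a)(b - x) <= M |x - z|^2 on [a, b]. *)
Lemma kernel_endpoints_independent z (c d : R[i]) : (0 < n)%N -> complex.Im z != 0 ->
  c * (kernel_poly s n a%:C).[z] + d * (kernel_poly s n b%:C).[z] = 0 ->
  c * (kernel_poly s n a%:C).[Num.conj z] + d * (kernel_poly s n b%:C).[Num.conj z] = 0 ->
  c = 0 /\ d = 0.
Proof.
move=> n_gt0 Im_z root_z root_zb.
set g := c *: kernel_poly s n a%:C + d *: kernel_poly s n b%:C.
have gL p : (size p <= n.+1)%N -> L (g * p) = c * p.[a%:C] + d * p.[b%:C].
  move=> size_p; rewrite /g mulrDl -!scalerAl linearD /= linearZ [L (d *: _)]linearZ /=.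
  by rewrite !(kernel_poly_reproducing pos_s).
have ab_neq0 : b%:C - a%:C != 0 :> R[i].
  by rewrite -rmorphB /= eq_complex /= eqxx andbT subr_eq0 gt_eqF.
have [g0|g_neq0] := eqVneq g 0.
  (* If g = 0, testing against X - b and X - a isolates c and d; this is where n > 0 provides degree
     1. *)
  have size_X (x : R[i]) : (size ('X - x%:P)%R <= n.+1)%N by rewrite size_XsubC.
  have := gL _ (size_X a%:C); have := gL _ (size_X b%:C).
  rewrite g0 !mul0r linear0 !hornerXsubC !subrr !mulr0 addr0 add0r => /esym/eqP + /esym/eqP.
  by rewrite -opprB mulrN oppr_eq0 !mulf_eq0 !(negPf ab_neq0) !orbF => /eqP-> /eqP->.
have size_g : (size g <= n.+1)%N.
  rewrite (leq_trans (size_polyD _ _)) // geq_max.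
  by rewrite !(leq_trans (size_scale_leq _ _)) // (size_Ppoly_comb pos_s (fun k => (P k).[_])).
have [h gE] : exists h, g = h * (('X - z%:P) * ('X - (Num.conj z)%:P)).
  have /factor_theorem[h1 gE1] : root g z by rewrite /root /g hornerD !hornerZ root_z.
  have /factor_theorem[h hE] : root h1 (Num.conj z).
    have zz_neq0 : Num.conj z - z != 0 by rewrite -oppr_eq0 opprB Im_neq0_conj.
    have := root_zb; rewrite -!hornerZ -hornerD -/g gE1 hornerM hornerXsubC => /eqP.
    by rewrite mulf_eq0 (negPf zz_neq0) orbF.
  by exists h; rewrite gE1 hE; ring.
have h_neq0 : h != 0 by apply: contraNneq g_neq0 => h0; rewrite gE h0 mul0r.
have size_h : (size h <= n.-1)%N.
  move: size_g; rewrite gE size_Mmonic ?monicMl ?monicXsubC //.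
  rewrite size_Mmonic ?monicXsubC ?polyXsubC_eq0 // !size_XsubC.
  have arith (m : nat) : (0 < m -> (m + 3).-1 <= n.+1 -> m <= n.-1)%N by lia.
  by apply: arith; rewrite size_poly_gt0.
pose W := Xa * bX; pose f := W * h.
have conj_W : conjp W = W by rewrite rmorphM /= conjp_Xsub conjp_subX.
have Wa : W.[a%:C] = 0 by rewrite hornerM hornerXsubC subrr mul0r.
have Wb : W.[b%:C] = 0 by rewrite /W mulrC hornerM hornerD hornerN hornerX hornerC subrr mul0r.
have gW : L (g * (W * conjp h)) = 0.
  rewrite gL; first by rewrite [_.[a%:C]]hornerM [_.[b%:C]]hornerM Wa Wb !mul0r !mulr0 addr0.
  rewrite (leq_trans (size_interval_weight_mul _)) // size_conjp; lia.
have f_gt0 : 0 < L (f * conjp f).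
  apply: pos_s; last by rewrite (leq_trans (size_interval_weight_mul _)) //; lia.
  by rewrite !mulf_neq0 // -size_poly_eq0 ?size_subX ?size_XsubC.
(* On [a, b] the weight is at most (b - a)^2, while |x - z|^2 is at least (Im z)^2. *)
pose M := ((b - a) ^+ 2 / complex.Im z ^+ 2).
suff : 0 <= L (M%:C *: (g * (W * conjp h)) - f * conjp f).
  by rewrite linearB linearZ /= gW mulr0 sub0r oppr_ge0 (lt_geF f_gt0).
have -> : M%:C *: (g * (W * conjp h)) - f * conjp f =
    W * (h * conjp h * (M%:C *: (('X - z%:P) * ('X - (Num.conj z)%:P)) - W)).
  by rewrite gE /f [conjp (W * h)]rmorphM /= conj_W -!mul_polyC; ring.
apply: nonneg_s => [|x /andP[le_ax le_xb]].
  have size_q : (size (M%:C *: (('X - z%:P) * ('X - (Num.conj z)%:P)) - W)%R <= 3)%N.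
    rewrite (leq_trans (size_polyD _ _)) // geq_max size_polyN.
    rewrite (leq_trans (size_scale_leq _ _)) ?(leq_trans (size_polyMleq _ _)) ?size_XsubC //.
    by rewrite size_subX.
  have arith (k l m e : nat) : (0 < m -> m <= n.-1 -> e <= 3 -> k <= (m + m).-1 ->
    l <= (k + e).-1 -> l.+2 <= n.*2.+1)%N by move: n_gt0; lia.
  rewrite (leq_trans (size_interval_weight_mul _)) //.
  apply: arith size_h size_q _ (size_polyMleq _ _); first by rewrite size_poly_gt0.
  by rewrite -{2}(size_conjp h) size_polyMleq.
rewrite hornerM [(h * conjp h * _).[_]]hornerM horner_mul_conjp hornerD hornerN hornerZ /W.
have -> : (Xa * bX).[x%:C] = ((x - a) * (b - x))%:C.
  by rewrite hornerM !hornerE rmorphM !rmorphB.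
have -> : (('X - z%:P) * ('X - (Num.conj z)%:P)).[x%:C] =
    ((x - complex.Re z) ^+ 2 + complex.Im z ^+ 2)%:C.
  rewrite hornerM !hornerXsubC; case: (z) => u v /=; apply/eqP; rewrite eq_complex /=.
  by apply/andP; split; apply/eqP; ring.
have weight_le : (x - a) * (b - x) <= M * ((x - complex.Re z) ^+ 2 + complex.Im z ^+ 2).
  have M_ge0 : 0 <= M by rewrite mulr_ge0 ?invr_ge0 ?sqr_ge0.
  apply: (@le_trans _ _ ((b - a) ^+ 2)); first by nra.
  rewrite -[leLHS](divfK (_ : complex.Im z ^+ 2 != 0)) ?expf_neq0 // -/M.
  by rewrite ler_wpM2l // lerDr sqr_ge0.
apply: mulr_ge0; first by rewrite ler0c mulr_ge0 // subr_ge0.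
by rewrite mulr_ge0 ?exprn_ge0 // -rmorphM -rmorphB ler0c subr_ge0.
Qed.

End NonnegativeFunctional.

(** * Representing measures and integration of polynomials *)

Section MomentMeasure.
Context {R : realType}.
Variables (a b : R) (n : nat) (s : nat -> R).
Implicit Types (mu nu : {measure set (measurableTypeR R) -> \bar R}).
Implicit Types (p q f g h r : {poly R[i]}).
Local Notation L := (Defs.Lfun s).
Local Notation I := (`[a, b]%classic : set (measurableTypeR R)).

Lemma Re_sum (m : nat) (F : 'I_m -> R[i]) :
  complex.Re (\sum_(k < m) F k) = \sum_(k < m) complex.Re (F k).
Proof. by apply: (big_morph (@complex.Re R)) => // -[? ?] [? ?]. Qed.

Lemma Re_mul_real (c : R[i]) (x : R) : complex.Re (c * x%:C) = complex.Re c * x.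
Proof. by case: c => u v /=; rewrite mulr0 subr0. Qed.

Section OneSolution.
Variables (mu : {measure set (measurableTypeR R) -> \bar R}).
Hypothesis sol_mu : solves_moment_problem a b n s mu.

Let mI : measurable I. Proof. exact: measurable_itv. Qed.

Lemma solution_finite : (mu I < +oo)%E.
Proof.
have := sol_mu.2 0%N (leq0n _).
under eq_integral do rewrite expr0.
by rewrite integral_cst // mul1e => ->; rewrite ltry.
Qed.

(** On [a, b] the monomial is bounded by (|a| + |b|)^k, and mu is finite there by its zeroth
    moment. *)
Lemma monomial_integrable k : mu.-integrable I (fun x => (x ^+ k)%:E).
Proof.
apply: (@le_integrable _ _ _ mu I _ _ (cst ((`|a| + `|b|) ^+ k)%:E)) => //.
- by apply/measurable_EFinP; exact: exprn_measurable.
- move=> x /=; rewrite in_itv /= => /andP[le_ax le_xb].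
  rewrite lee_fin normrX [leRHS]ger0_norm ?exprn_ge0 ?addr_ge0 //.
  rewrite lerXn2r ?nnegrE ?addr_ge0 // ler_norml.
  by have := ler_norm b; have := ler_norm (- a); have := normr_ge0 a; have := normr_ge0 b;
    rewrite normrN => *; apply/andP; split; lra.
- apply/integrableP; split; first exact: measurable_cst.
  rewrite /= integral_cst // lte_mul_pinfty ?solution_finite //.
Qed.

Lemma Re_horner_real p (x : R) :
  complex.Re p.[x%:C] = \sum_(k < size p) complex.Re p`_k * x ^+ k.
Proof.
rewrite horner_coef Re_sum; apply: eq_bigr => k _.
by rewrite -rmorphXn Re_mul_real.
Qed.

Lemma Re_horner_integrable p : mu.-integrable I (fun x => (complex.Re p.[x%:C])%:E).
Proof.
have -> : (fun x : R => (complex.Re p.[x%:C])%:E) =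
    (fun x => (\sum_(k < size p) ((complex.Re p`_k)%:E * (x ^+ k)%:E))%E).
  by apply/funext => x; rewrite Re_horner_real sumEFin.
apply: integrable_sum => // k _.
by apply: integrableZl => //; exact: monomial_integrable.
Qed.

Lemma integral_Re_horner p : (size p <= n.*2.+1)%N ->
  (\int[mu]_(x in I) (complex.Re p.[x%:C])%:E = (complex.Re (L p))%:E)%E.
Proof.
move=> size_p.
have -> : (fun x : R => (complex.Re p.[x%:C])%:E) =
    (fun x => (\sum_(k < size p) ((complex.Re p`_k)%:E * (x ^+ k)%:E))%E).
  by apply/funext => x; rewrite Re_horner_real sumEFin.
rewrite integral_sum //; last first.
  by move=> k; apply: integrableZl => //; exact: monomial_integrable.
rewrite /Defs.Lfun Re_sum -sumEFin; apply: eq_bigr => k _.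
rewrite integralZl //; last exact: monomial_integrable.
rewrite sol_mu.2 ?Re_mul_real // mul2n -ltnS.
exact: leq_trans (ltn_ord k) size_p.
Qed.

(** The order of [R[i]] also demands a zero imaginary part; it is the real part of L(-i p), whose
    integrand vanishes on [a, b]. *)
Lemma solution_nonneg p : (size p <= n.*2.+1)%N ->
  (forall x : R, a <= x <= b -> 0 <= p.[x%:C]) -> 0 <= L p.
Proof.
move=> size_p p_ge0.
have size_ip : (size ((- 'i) *: p)%R <= n.*2.+1)%N.
  exact: leq_trans (size_scale_leq _ _) size_p.
have ImE (c : R[i]) : complex.Im c = complex.Re ((- 'i) * c).
  by case: c => u v /=; lra.
rewrite lecE /=; apply/andP; split.
  rewrite ImE -linearZ /= -eqe -integral_Re_horner //.
  rewrite (eq_integral (cst 0%E)) ?integral0 // => x; rewrite inE /= in_itv /= => /p_ge0.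
  by rewrite hornerZ -ImE lecE /= => /andP[/eqP-> _].
rewrite -lee_fin -integral_Re_horner //; apply: integral_ge0 => x /=.
by rewrite in_itv /= => /p_ge0; rewrite lecE lee_fin => /andP[].
Qed.

Lemma solution_null p : (size p <= n.*2.+1)%N ->
  (forall x : R, a <= x <= b -> 0 <= p.[x%:C]) -> L p = 0 ->
  {ae mu, forall x : measurableTypeR R, I x -> p.[(x : R)%:C] = 0}.
Proof.
move=> size_p p_ge0 Lp.
have /ae_eq_integral_abs : (\int[mu]_(x in I) `|(complex.Re p.[x%:C])%:E| = 0)%E.
  transitivity (complex.Re (L p))%:E; last by rewrite Lp.
  rewrite -integral_Re_horner //; apply: eq_integral => x; rewrite inE /= in_itv /= => /p_ge0.
  by rewrite lecE /= => /andP[_ Rp]; rewrite ger0_norm.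
move=> /(_ mI (measurable_int _ (Re_horner_integrable p))).
apply: filterS => x Rp0 Ix; have := p_ge0 x; move: (Ix); rewrite /= in_itv /= => -> /(_ isT).
rewrite lecE /= => /andP[/eqP Imp _]; have [Rp] := Rp0 Ix.
by apply/eqP; rewrite eq_complex Rp Imp /= !eqxx.
Qed.

(** The measure lives on the zeros of p, where q is the indicator of A. The resulting value does not
    mention mu, so it is common to all solutions. *)
Lemma solution_measure p q (A : set (measurableTypeR R)) : measurable A ->
  (size p <= n.*2.+1)%N -> (size q <= n.*2.+1)%N ->
  (forall x : R, a <= x <= b -> 0 <= p.[x%:C]) -> L p = 0 ->
  (forall x : R, p.[x%:C] = 0 -> q.[x%:C] = (\1_A x)%:C) ->
  mu A = (complex.Re (L q))%:E.
Proof.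
move=> mA size_p size_q p_ge0 Lp qA.
have -> : mu A = mu (A `&` I)%classic.
  rewrite (measureDI _ mA mI) [X in (X + _)%E](_ : _ = 0%E) ?add0e //.
  apply: (subset_measure0 _ _ _ sol_mu.1).
  - exact: measurableD.
  - exact: measurableC.
  - by move=> x [].
rewrite -integral_indic // -integral_Re_horner //; apply: ae_eq_integral => //.
- by apply/measurable_EFinP; exact: measurable_indic.
- exact: measurable_int (Re_horner_integrable q).
apply: filterS (solution_null size_p p_ge0 Lp) => x px0 Ix.
by rewrite qA // px0.
Qed.

End OneSolution.
End MomentMeasure.

(** * Interpolation, and uniqueness of the solution when D(a, b) = 0 *)

Lemma interpolation (F : fieldType) (zs : seq F) (v : F -> F) : uniq zs ->
  exists2 q : {poly F}, (size q <= size zs)%N & {in zs, forall y, q.[y] = v y}.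
Proof.
elim: zs => [|z zs IHzs] /=; first by exists 0; rewrite ?size_poly0.
move=> /andP[z_zs uniq_zs]; have [q size_q qE] := IHzs uniq_zs.
pose N := \prod_(y <- zs) ('X - y%:P).
have Nz : N.[z] != 0 by rewrite -/(root N z) root_prod_XsubC.
exists (q + ((v z - q.[z]) / N.[z]) *: N).
  rewrite (leq_trans (size_polyD _ _)) // geq_max (leq_trans size_q) //=.
  by rewrite (leq_trans (size_scale_leq _ _)) // size_prod_XsubC.
move=> y; rewrite inE hornerD hornerZ => /predU1P[-> | y_zs].
  by rewrite divfK // addrC subrK.
by have /eqP -> : root N y; rewrite ?root_prod_XsubC // mulr0 addr0 qE.
Qed.

(* If D(a, b) = 0 then K(a, .) = (x - b) h, so (x - a)(b - x) |h|^2 has zero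
   integral and every solution lives on at most n + 1 points, where an indicator
   function agrees with a polynomial of degree at most n. *)
Lemma Dfun_endpoints_neq0 (R : realType) (a b : R) (n : nat) (s : nat -> R) : a < b ->
  positive_definite_upto s n -> indeterminate_moment_problem a b n s ->
  Dfun s n a%:C b%:C != 0.
Proof.
move=> lt_ab pos_s [mu [nu [sol_mu sol_nu [A [mA neq_A]]]]].
apply: contra_notN neq_A => Dab.
have ab_neq0 : a%:C - b%:C != 0 :> R[i].
  by rewrite -rmorphB /= eq_complex /= eqxx andbT subr_eq0 lt_eqF.
set K := kernel_poly s n a%:C.
have /factor_theorem[h KE] : root K b%:C.
  have : (a%:C - b%:C) * K.[b%:C] == 0.
    by move: Dab; rewrite DfunE // hornerM hornerD hornerN hornerX hornerC.
  by rewrite mulf_eq0 (negPf ab_neq0).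
(* Pairing K(a, .) with the constant 1 gives 1. *)
have K_neq0 : K != 0.
  apply/eqP => K0.
  have := kernel_poly_reproducing pos_s a%:C (_ : (size (1%R : {poly R[i]}) <= n.+1)%N).
  by rewrite size_poly1 -/K K0 mul0r linear0 hornerC => /(_ isT) /esym /eqP; rewrite oner_eq0.
have h_neq0 : h != 0 by apply: contraNneq K_neq0 => h0; rewrite KE h0 mul0r.
have size_h : (size h <= n)%N.
  have := size_Ppoly_comb pos_s (fun k => (Ppoly s k).[a%:C]); rewrite -/(kernel_poly s n a%:C) -/K.
  rewrite KE size_Mmonic ?monicXsubC // size_XsubC.
  have arith (m : nat) : ((m + 2).-1 <= n.+1 -> m <= n)%N by lia.
  exact: arith.
pose h' := map_poly Num.conj h.
pose W : {poly R[i]} := ('X - (a%:C)%:P) * ((b%:C)%:P - 'X).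
have size_p : (size (W * (h * h'))%R <= n.*2.+1)%N.
  rewrite (leq_trans (size_interval_weight_mul _ _ _)) //.
  have arith (l m : nat) : (0 < m -> m <= n -> l <= (m + m).-1 -> l.+2 <= n.*2.+1)%N by lia.
  apply: arith size_h _; first by rewrite size_poly_gt0.
  by rewrite -{2}(size_conjp h) size_polyMleq.
have p_ge0 (x : R) : a <= x <= b -> 0 <= (W * (h * h')).[x%:C].
  move=> /andP[le_ax le_xb]; rewrite hornerM horner_mul_conjp mulr_ge0 ?exprn_ge0 //.
  by rewrite hornerM !hornerE -!rmorphB mulr_ge0 // ler0c subr_ge0.
have Lp : Defs.Lfun s (W * (h * h')) = 0.
  (* The kernel at a then evaluates a polynomial divisible by X - a at the point a. *)
  have -> : W * (h * h') = - (K * (('X - (a%:C)%:P) * h')) by rewrite KE /W; ring.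
  rewrite linearN /= (kernel_poly_reproducing pos_s) ?hornerM ?hornerXsubC ?subrr ?mul0r ?oppr0 //.
  rewrite (leq_trans (size_polyMleq _ _)) // size_XsubC size_conjp.
  by [].
have [rs hE] := closed_field_poly_normal h.
pose zs := undup [:: a%:C, b%:C & rs].
have size_zs : (size zs <= n.*2.+1)%N.
  apply: (leq_trans (size_undup _)) => /=.
  have size_rs : size h = (size rs).+1 by rewrite hE size_scale ?lead_coef_eq0 // size_prod_XsubC.
  have arith (m k : nat) : (m = k.+1 -> m <= n -> k.+2 <= n.*2.+1)%N by lia.
  exact: arith size_rs size_h.
(* Some roots of h may be non-real, so the prescribed value reads the real part; later only real
   nodes are evaluated. *)
have [q size_q qE] :=
  interpolation (fun y => (\1_A (complex.Re y))%:C) (undup_uniq [:: a%:C, b%:C & rs]).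
have qA (x : R) : (W * (h * h')).[x%:C] = 0 -> q.[x%:C] = (\1_A x)%:C.
  move=> /eqP; rewrite hornerM horner_mul_conjp hornerM !hornerE !mulf_eq0 => px0.
  have h_root : `|h.[x%:C]| == 0 -> x%:C \in rs.
    rewrite normr_eq0 hE hornerZ mulf_eq0 lead_coef_eq0 (negPf h_neq0) /=.
    by rewrite -/(root _ _) root_prod_XsubC.
  rewrite qE // mem_undup !inE.
  case/orP: px0 => [/orP[/orP[xa|bx]|/h_root->]|/h_root->]; rewrite ?orbT //.
    by rewrite -subr_eq0 xa.
  by rewrite -[x%:C == b%:C]subr_eq0 -oppr_eq0 opprB bx orbT.
rewrite (solution_measure sol_mu mA size_p _ p_ge0 Lp qA) ?(leq_trans size_q) //.
by rewrite (solution_measure sol_nu mA size_p _ p_ge0 Lp qA) ?(leq_trans size_q).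
Qed.

(** * Two-by-two determinants and circles as Moebius images of real lines *)

Lemma det2E (K : comNzRingType) (x11 x12 x21 x22 : K) :
  det2 x11 x12 x21 x22 = x11 * x22 - x12 * x21.
Proof.
have detE (M : 'M[K]_(1 + 1)) : \det M =
    M (lshift 1 0) (lshift 1 0) * M (rshift 1 0) (rshift 1 0) -
    M (lshift 1 0) (rshift 1 0) * M (rshift 1 0) (lshift 1 0).
  rewrite (expand_det_row _ (lshift 1 0)) big_split_ord /= !big_ord1 /cofactor !det_mx11 !mxE /=.
  rewrite !(addn0, add0n, expr0, expr1) /= mul1r mulN1r mulrN.
  by congr (_ * M _ _ - _ * M _ _); apply: val_inj.
by rewrite /det2 detE block_mxEul block_mxEur block_mxEdl block_mxEdr !mxE.
Qed.

Section Circles.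
Context {R : realType}.
Implicit Types (u v p q F G m r : R[i]).

(** A zero of pF + qG and its conjugate form a homogeneous linear system in the real pair (F, G)
    with the nonzero determinant p conj(q) - q conj(p). *)
Lemma real_combination_neq0 p q F G :
  Num.conj F = F -> Num.conj G = G -> (F != 0) || (G != 0) ->
  p * Num.conj q - q * Num.conj p != 0 -> p * F + q * G != 0.
Proof.
move=> conjF conjG FG_neq0; apply: contraNneq => pFqG.
have pFqG' : Num.conj p * F + Num.conj q * G = 0.
  by rewrite -conjF -conjG -!rmorphM -rmorphD pFqG rmorph0.
have /eqP : F * (p * Num.conj q - q * Num.conj p) = 0.
  transitivity ((p * F + q * G) * Num.conj q -
    q * (Num.conj p * F + Num.conj q * G)); first by ring.
  by rewrite pFqG pFqG' mul0r mulr0 subrr.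
have /eqP : G * (p * Num.conj q - q * Num.conj p) = 0.
  transitivity (p * (Num.conj p * F + Num.conj q * G) -
    (p * F + q * G) * Num.conj p); first by ring.
  by rewrite pFqG pFqG' mul0r mulr0 subrr.
by rewrite !mulf_eq0; case/orP: FG_neq0 => /negPf->.
Qed.

(* The two points differ by (uq - vp) / (p q^* - q p^* ) times X^* / X, with
   X = pF + qG. *)
Lemma moebius_real_line_circle u v p q F G :
  Num.conj F = F -> Num.conj G = G -> (F != 0) || (G != 0) ->
  p * Num.conj q - q * Num.conj p != 0 ->
  `|- ((u * F + v * G) / (p * F + q * G)) -
    - ((u * Num.conj q - v * Num.conj p) / (p * Num.conj q - q * Num.conj p))| =
  `|(u * q - v * p) / (p * Num.conj q - q * Num.conj p)|.
Proof.
move=> conjF conjG FG_neq0 pq_neq0.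
have pFqG_neq0 := real_combination_neq0 conjF conjG FG_neq0 pq_neq0.
have -> : - ((u * F + v * G) / (p * F + q * G)) -
    - ((u * Num.conj q - v * Num.conj p) / (p * Num.conj q - q * Num.conj p)) =
    (u * q - v * p) / (p * Num.conj q - q * Num.conj p) *
    (Num.conj (p * F + q * G) / (p * F + q * G)).
  by rewrite rmorphD !rmorphM /= conjF conjG; field; apply/andP; split.
by rewrite normrM [X in _ * X]normf_div norm_conjC divff ?mulr1 // normr_eq0.
Qed.

Lemma circle_through_3 (w0 w1 w2 m m' r r' : R[i]) :
  w0 != w1 -> w1 != w2 -> w0 != w2 ->
  `|w0 - m| = r -> `|w1 - m| = r -> `|w2 - m| = r ->
  `|w0 - m'| = r' -> `|w1 - m'| = r' -> `|w2 - m'| = r' -> m' = m /\ r' = r.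
Proof.
move=> n01 n12 n02 c0 c1 c2 c0' c1' c2'.
suff mm : m' = m by split=> //; rewrite -c0' mm.
apply/eqP; apply: contraTT isT => d_neq0; rewrite -subr_eq0 in d_neq0.
(* The w_i would be three roots of one quadratic with leading coefficient (m' - m)^*. *)
have chord (x : R[i]) : `|x - m| = r -> `|x - m'| = r' ->
    (x - m) * Num.conj (m' - m) + Num.conj (x - m) * (m' - m) =
    (m' - m) * Num.conj (m' - m) + r ^+ 2 - r' ^+ 2.
  by move=> <- <-; rewrite !normCK !rmorphB; ring.
(* Multiplying [chord] by x - m removes conj(x - m); subtracting the same for y and dividing by x -
   y fixes the sum x + y. *)
have cross (x y : R[i]) : x != y -> `|x - m| = r -> `|y - m| = r ->
    `|x - m'| = r' -> `|y - m'| = r' ->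
    (x + y - 2 * m) * Num.conj (m' - m) = (m' - m) * Num.conj (m' - m) + r ^+ 2 - r' ^+ 2.
  rewrite -subr_eq0 => xy_neq0 xm ym xm' ym'; apply: (mulfI xy_neq0).
  transitivity ((x - m) * ((x - m) * Num.conj (m' - m) + Num.conj (x - m) * (m' - m))
      - `|x - m| ^+ 2 * (m' - m)
    - ((y - m) * ((y - m) * Num.conj (m' - m) + Num.conj (y - m) * (m' - m))
      - `|y - m| ^+ 2 * (m' - m))); first by rewrite !normCK !rmorphB; ring.
  by rewrite !chord // xm ym; ring.
have conj_d_neq0 : Num.conj (m' - m) != 0 by rewrite conjC_eq0.
have /(mulIf conj_d_neq0) :
    (w0 + w1 - 2 * m) * Num.conj (m' - m) = (w0 + w2 - 2 * m) * Num.conj (m' - m).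
  by rewrite !cross.
by move=> /addIr /addrI /eqP; rewrite (negPf n12).
Qed.

(** The points at t = 0, 1 and +oo suffice: their differences are, up to sign, AD - BC over products
    of the denominators D, C + D and C. *)
Lemma only_circle_moebius (A B C D m r : R[i]) :
  A * D - B * C != 0 -> C != 0 -> D != 0 -> C + D != 0 ->
  arc_on_circle (fun t => - moebius A B C D t) m r ->
  only_circle_through_arc (fun t => - moebius A B C D t) m r.
Proof.
move=> det_neq0 C_neq0 D_neq0 CD_neq0 arc m' r' arc'.
have le00 : (0 <= 0%:E :> \bar R)%E by [].
have le01 : (0 <= 1%:E :> \bar R)%E by rewrite lee_fin.
have le0y : (0 <= +oo :> \bar R)%E by [].
apply: (circle_through_3 _ _ _ (arc _ le00) (arc _ le01) (arc _ le0y)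
  (arc' _ le00) (arc' _ le01) (arc' _ le0y)).
- rewrite /= eqr_opp !(mulr0, add0r, mulr1) eqr_div // -subr_eq0.
  by apply: contraNneq det_neq0 => e; rewrite -oppr_eq0 -e; apply/eqP; ring.
- rewrite /= eqr_opp !(mulr0, add0r, mulr1) eqr_div // -subr_eq0.
  by apply: contraNneq det_neq0 => e; rewrite -oppr_eq0 -e; apply/eqP; ring.
- rewrite /= eqr_opp !(mulr0, add0r, mulr1) eqr_div // -subr_eq0.
  by apply: contraNneq det_neq0 => e; rewrite -oppr_eq0 -e; apply/eqP; ring.
Qed.

End Circles.

(** * Centres and radii of the two circles *)

Section Arcs.
Context {R : realType}.
Variables (a b : R) (n : nat) (s : nat -> R) (z : R[i]).
Hypotheses (lt_ab : a < b) (pos_s : positive_definite_upto s n) (Im_z : complex.Im z != 0).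
Hypothesis nonneg_s : forall p : {poly R[i]}, (size p <= n.*2.+1)%N ->
  (forall x : R, a <= x <= b -> 0 <= p.[x%:C]) -> 0 <= Defs.Lfun s p.
Local Notation C := (Cfun s n).
Local Notation D := (Dfun s n).
Local Notation P := (Ppoly s n).
Local Notation zb := (Num.conj z).

Let sign_conj : Num.conj ((-1) ^+ n : R[i]) = (-1) ^+ n.
Proof. by rewrite rmorphXn rmorphN rmorph1. Qed.

Let P_real_conj (x : R) : Num.conj P.[x%:C] = P.[x%:C].
Proof. by rewrite -(horner_Ppoly_conj pos_s) ?conj_real_complex. Qed.

Let Pa_neq0 : P.[a%:C] != 0.
Proof.
have := Pn_endpoints_sign pos_s lt_ab nonneg_s; apply: contraTneq => ->.
by rewrite mul0r mulr0 ltxx.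
Qed.

Lemma sub_real_neq0 (x : R) : z - x%:C != 0.
Proof.
apply: contra Im_z; rewrite subr_eq0 => /eqP->.
by rewrite /= eqxx.
Qed.

(** Up to P_n(a), D(z, conj z) is the determinant p conj(q) - q conj(p) for p = D(z, a) and q =
    P_n(z), as [moebius_real_line_circle] requires. *)
Lemma Dfun_conj_Wronskian :
  P.[a%:C] * D z zb = D z a%:C * Num.conj P.[z] - P.[z] * Num.conj (D z a%:C).
Proof.
by rewrite (Dfun_expansion pos_s) // (horner_Ppoly_conj pos_s) // [D a%:C zb]Dfun_antisym
  (Dfun_conj_real pos_s) mulrN.
Qed.

Lemma m1E : m1 s n z = - ((C z a%:C * Num.conj P.[z] - Qfun s n z * Num.conj (D z a%:C)) /
  (D z a%:C * Num.conj P.[z] - P.[z] * Num.conj (D z a%:C))).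
Proof.
rewrite /m1 -(mulKf Pa_neq0 (C z zb)) -(mulKf Pa_neq0 (D z zb)) Dfun_conj_Wronskian.
rewrite (Cfun_expansion pos_s) // (horner_Ppoly_conj pos_s) // [D a%:C zb]Dfun_antisym.
rewrite (Dfun_conj_real pos_s) mulrN invfM invrK; congr (- _); field.
by rewrite Pa_neq0 -Dfun_conj_Wronskian mulf_neq0 ?(Dfun_diag_neq0 pos_s).
Qed.

(** The numerator is the Wronskian P_n(a), which cancels the factor P_n(a) of the denominator. *)
Lemma r1E : r1 s n z = `|(C z a%:C * P.[z] - Qfun s n z * D z a%:C) /
  (D z a%:C * Num.conj P.[z] - P.[z] * Num.conj (D z a%:C))|.
Proof.
rewrite (Cfun_Dfun_Wronskian pos_s) // -Dfun_conj_Wronskian invfM mulrA divff //.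
by rewrite mul1r normfV /r1 div1r.
Qed.

Let Wronskian_neq0 : D z a%:C * Num.conj P.[z] - P.[z] * Num.conj (D z a%:C) != 0.
Proof. by rewrite -Dfun_conj_Wronskian mulf_neq0 ?(Dfun_diag_neq0 pos_s). Qed.

(* The combination of P_n(a) and P_n(b) matching the numerator and denominator of w1;
   it is nonzero for x >= 0 because of the sign (-1)^n. *)
Let F (x : R) := (-1) ^+ n * x%:C * P.[a%:C] + P.[b%:C].

Lemma F_neq0 (x : R) : 0 <= x -> F x != 0.
Proof.
move=> x_ge0; have Fgt0 : 0 < (-1) ^+ n * P.[a%:C] * F x.
  have -> : (-1) ^+ n * P.[a%:C] * F x =
      x%:C * P.[a%:C] ^+ 2 + (-1) ^+ n * (P.[a%:C] * P.[b%:C]).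
    transitivity (((-1) ^+ n) ^+ 2 * (x%:C * P.[a%:C] ^+ 2) +
      (-1) ^+ n * (P.[a%:C] * P.[b%:C])); first by rewrite /F; ring.
    by rewrite sqrr_sign mul1r.
  rewrite ltr_wpDl ?(Pn_endpoints_sign pos_s lt_ab nonneg_s) //.
  by rewrite mulr_ge0 ?ler0c // real_exprn_even_ge0 //; apply/CrealP; rewrite P_real_conj.
by apply: contraTneq Fgt0 => ->; rewrite mulr0 ltxx.
Qed.

Let F_conj (x : R) : Num.conj (F x) = F x.
Proof. by rewrite /F rmorphD !rmorphM /= sign_conj conj_real_complex !P_real_conj. Qed.

Let Dab_conj : Num.conj (D a%:C b%:C) = D a%:C b%:C.
Proof. by rewrite -(Dfun_conj_real pos_s) conj_real_complex. Qed.

(** With [denE], this writes w1 as a Moebius map of the real pair (F x, D(a, b)). *)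
Let numE (x : R) : P.[a%:C] * ((-1) ^+ n * C z a%:C * x%:C + C z b%:C) =
  C z a%:C * F x + Qfun s n z * D a%:C b%:C.
Proof. by rewrite mulrDr (Cfun_expansion pos_s) // /F; ring. Qed.

Let denE (x : R) : P.[a%:C] * ((-1) ^+ n * D z a%:C * x%:C + D z b%:C) =
  D z a%:C * F x + P.[z] * D a%:C b%:C.
Proof. by rewrite mulrDr (Dfun_expansion pos_s) // /F; ring. Qed.

Let den1_neq0 (x : R) : 0 <= x -> (-1) ^+ n * D z a%:C * x%:C + D z b%:C != 0.
Proof.
move=> x_ge0; suff : P.[a%:C] * ((-1) ^+ n * D z a%:C * x%:C + D z b%:C) != 0.
  by rewrite mulf_eq0 negb_or => /andP[].
by rewrite denE real_combination_neq0 ?F_conj ?F_neq0.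
Qed.

Let Dza_neq0 : D z a%:C != 0.
Proof.
have := @real_combination_neq0 _ (D z a%:C) P.[z] 1 0 (rmorph1 _) (rmorph0 _).
by rewrite oner_eq0 mulr1 mulr0 addr0; apply.
Qed.

Lemma w1_on_circle : arc_on_circle (w1 s n a b z) (m1 s n z) (r1 s n z).
Proof.
rewrite m1E r1E => -[x||] //= x_ge0; last first.
  (* At t = +oo the sign cancels and the real pair is (1, 0). *)
  rewrite /w1 /= -mulf_div divff ?signr_eq0 // mul1r.
  have := @moebius_real_line_circle _ (C z a%:C) (Qfun s n z) (D z a%:C) P.[z] 1 0
    (rmorph1 _) (rmorph0 _) _ Wronskian_neq0.
  by rewrite oner_eq0 !mulr1 !mulr0 !addr0; apply.
rewrite lee_fin in x_ge0.
rewrite /w1 /= -(mulKf Pa_neq0 (_ * x%:C + C z b%:C)) numE.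
rewrite -(mulKf Pa_neq0 (_ * x%:C + D z b%:C)) denE invfM invrK mulrACA mulVf // mul1r.
by apply: moebius_real_line_circle; rewrite ?F_conj ?F_neq0.
Qed.

Lemma w1_only_circle : D a%:C b%:C != 0 ->
  only_circle_through_arc (w1 s n a b z) (m1 s n z) (r1 s n z).
Proof.
move=> Dab_neq0; apply: only_circle_moebius w1_on_circle.
- rewrite (_ : _ - _ = (-1) ^+ n * (C z a%:C * D z b%:C - C z b%:C * D z a%:C)); last by ring.
  by rewrite (Cfun_Dfun_det pos_s) // mulf_neq0 ?signr_eq0.
- by rewrite mulf_neq0 ?signr_eq0.
- by have := den1_neq0 (lexx 0); rewrite mulr0 add0r.
- by have := den1_neq0 ler01; rewrite mulr1.
Qed.

Lemma conj_weighted_Dfun (x y : R) :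
  Num.conj ((z - x%:C) * D z y%:C) = (zb - x%:C) * D zb y%:C.
Proof.
by rewrite rmorphM (Dfun_conj_real pos_s) rmorphB /= conj_real_complex.
Qed.

Lemma den2E : den2 s n a b z =
  (z - b%:C) * D z a%:C * Num.conj ((z - a%:C) * D z b%:C) -
  (z - a%:C) * D z b%:C * Num.conj ((z - b%:C) * D z a%:C).
Proof.
by rewrite /den2 det2E !conj_weighted_Dfun.
Qed.

(** Extracting |(z - a)(z - b)|^2 leaves Ka conj(Kb) - Kb conj(Ka). If this were 0, Kb K(a, .) - Ka
    K(b, .) would vanish at z and conj z, so Ka = Kb = 0 by independence; then K(a, .) alone
    contradicts independence. *)
Lemma den2_neq0 : (0 < n)%N -> den2 s n a b z != 0.
Proof.
move=> n_gt0.
have DE (x : R) : D z x%:C = (z - x%:C) * (kernel_poly s n x%:C).[z].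
  rewrite horner_sum /Dfun; congr (_ * _); apply: eq_bigr => k _.
  by rewrite hornerZ mulrC.
have conj_K (x : R) : (kernel_poly s n x%:C).[zb] = Num.conj (kernel_poly s n x%:C).[z].
  rewrite !horner_sum rmorph_sum; apply: eq_bigr => k _; rewrite !hornerZ rmorphM /=.
  by rewrite -!(horner_Ppoly_conj pos_s) ?conj_real_complex // -ltnS.
set Ka := (kernel_poly s n a%:C).[z] in DE *; set Kb := (kernel_poly s n b%:C).[z].
have indep := kernel_endpoints_independent pos_s lt_ab nonneg_s n_gt0 Im_z.
have -> : den2 s n a b z = (z - b%:C) * (z - a%:C) * Num.conj ((z - b%:C) * (z - a%:C)) *
    (Ka * Num.conj Kb - Kb * Num.conj Ka).
  by rewrite den2E !DE !rmorphM -/Ka -/Kb; ring.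
rewrite !mulf_neq0 ?conjC_eq0 ?mulf_neq0 ?sub_real_neq0 //.
apply/eqP => cross0.
have [Kb0 /eqP] : Kb = 0 /\ - Ka = 0.
  apply: indep; first by rewrite -/Ka -/Kb; ring.
  by rewrite !conj_K -/Ka -/Kb -[RHS]oppr0 -cross0; ring.
rewrite oppr_eq0 => /eqP Ka0.
have [/eqP] : 1 = 0 :> R[i] /\ 0 = 0 :> R[i].
  by apply: indep; rewrite ?conj_K -/Ka Ka0 ?rmorph0 mulr0 mul0r addr0.
by rewrite oner_eq0.
Qed.

Lemma m2E : m2 s n a b z =
  - (((z - b%:C) * C z a%:C * Num.conj ((z - a%:C) * D z b%:C) -
      (z - a%:C) * C z b%:C * Num.conj ((z - b%:C) * D z a%:C)) / den2 s n a b z).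
Proof.
by rewrite /m2 det2E !conj_weighted_Dfun.
Qed.

Lemma r2E : r2 s n a b z =
  `|((z - b%:C) * C z a%:C * ((z - a%:C) * D z b%:C) -
      (z - a%:C) * C z b%:C * ((z - b%:C) * D z a%:C)) / den2 s n a b z|.
Proof.
rewrite /r2 -(Cfun_Dfun_det pos_s z b%:C Pa_neq0); congr (`|_ / _|).
by ring.
Qed.

(** Here the real pair is ((-1)^n t, 1) itself, and ((-1)^n, 0) at t = +oo; [den2] is the
    determinant p conj(q) - q conj(p). *)
Lemma w2_on_circle : (0 < n)%N ->
  arc_on_circle (w2 s n a b z) (m2 s n a b z) (r2 s n a b z).
Proof.
move=> /den2_neq0 den_neq0; rewrite m2E r2E den2E in den_neq0 *.
have circle := @moebius_real_line_circle _ ((z - b%:C) * C z a%:C) ((z - a%:C) * C z b%:C)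
   ((z - b%:C) * D z a%:C) ((z - a%:C) * D z b%:C).
case=> [x||] //= x_ge0; rewrite /w2 /=.
  have := circle ((-1) ^+ n * x%:C) 1 _ (rmorph1 _) _ den_neq0.
  rewrite oner_eq0 orbT !mulr1 rmorphM /= sign_conj conj_real_complex.
  move=> /(_ erefl isT) <-; congr (`|- (_ / _) - _|); ring.
have := circle ((-1) ^+ n) 0 sign_conj (rmorph0 _) _ den_neq0.
rewrite signr_eq0 !mulr0 !addr0 => /(_ isT) <-; congr (`|- (_ / _) - _|); ring.
Qed.

Lemma w2_only_circle : (0 < n)%N -> D a%:C b%:C != 0 ->
  only_circle_through_arc (w2 s n a b z) (m2 s n a b z) (r2 s n a b z).
Proof.
move=> n_gt0 Dab_neq0; apply: only_circle_moebius (w2_on_circle n_gt0).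
- rewrite (_ : _ - _ = (-1) ^+ n * ((z - a%:C) * (z - b%:C)) *
     (C z a%:C * D z b%:C - C z b%:C * D z a%:C)); last by ring.
  rewrite (Cfun_Dfun_det pos_s) //; apply: mulf_neq0 => //.
  by apply: mulf_neq0; rewrite ?signr_eq0 // mulf_neq0 ?sub_real_neq0.
- apply: mulf_neq0 => //; apply: mulf_neq0; rewrite ?signr_eq0 //.
  exact: sub_real_neq0.
- rewrite mulf_neq0 ?sub_real_neq0 //.
  by have := den1_neq0 (lexx 0); rewrite mulr0 add0r.
- have := den2_neq0 n_gt0; rewrite den2E => den_neq0.
  have := @real_combination_neq0 _ _ _ ((-1) ^+ n) 1 sign_conj (rmorph1 _) _ den_neq0.
  rewrite signr_eq0 mulr1 => /(_ isT).
  by rewrite [_ * (-1) ^+ n]mulrAC.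
Qed.

End Arcs.

(** * The degenerate second arc for n = 0, and the conclusion *)

Lemma degree0_line (R : realType) (a b : R) (s : nat -> R) (z : R[i]) : a < b ->
  complex.Im z != 0 -> positive_definite_upto s 0 ->
  den2 s 0 a b z = 0 /\ arc_on_line (w2 s 0 a b z).
Proof.
move=> lt_ab Im_z pos_s.
have [c c_neq0 P0] := Ppoly0_const pos_s.
have DE w y : Dfun s 0 w y = (w - y) * c ^+ 2.
  by rewrite /Dfun big_ord1 P0 !hornerC.
have CE w y : Cfun s 0 w y = 1.
  rewrite /Cfun big_ord1 /Qfun P0 hornerC subrr div0p.
  by rewrite linear0 mul0r mulr0 addr0.
have za := sub_real_neq0 Im_z a; have zb := sub_real_neq0 Im_z b.
split; first by rewrite den2E // !DE !rmorphM; ring.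
have ba_neq0 : b%:C - a%:C != 0 :> R[i].
  by rewrite -rmorphB /= eq_complex /= eqxx andbT subr_eq0 gt_eqF.
(* Both denominator coefficients of w2 equal X and C = 1, so w2(t) = -(z - a)/X + t/(t + 1) (b -
   a)/X, a segment whose end t = +oo has parameter 1. *)
pose X := (z - a%:C) * (z - b%:C) * c ^+ 2.
have X_neq0 : X != 0 by rewrite !mulf_neq0 ?expf_neq0.
exists (- ((z - a%:C) / X)), ((b%:C - a%:C) / X).
split; first by rewrite mulf_neq0 ?invr_eq0.
case=> [x||] //= x_ge0; rewrite /w2 /= !DE !CE expr0 !mulr1.
  rewrite lee_fin in x_ge0.
  have x1_neq0 : x + 1 != 0 by rewrite gt_eqF // ltr_wpDl.
  exists (x / (x + 1)).
  have x1_neq0' : x%:C + 1 != 0 :> R[i].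
    by rewrite -(rmorph1 (real_complex R)) -rmorphD /= eq_complex /= eqxx andbT.
  rewrite rmorphM fmorphV rmorphD rmorph1 /X; field.
  apply/and5P; split=> //.
  rewrite [X in X != 0](_ : _ = X * (x%:C + 1)); last by rewrite /X; ring.
  exact: mulf_neq0.
exists 1; rewrite /X; field.
by apply/and3P; split.
Qed.

(** Indeterminacy gives D(a, b) != 0, which keeps each arc from collapsing to a point; for n = 0 the
    formulas for the second circle would divide by zero, hence the separate clause. *)
Theorem theorem5p2 (R : realType) (a b : R) (hab : a < b) (n : nat)
    (s : nat -> R)
    (hs : exists mu : {measure set (measurableTypeR R) -> \bar R},
        solves_moment_problem a b n s mu)
    (hpos : positive_definite_upto s n)
    (z : R[i]) (hz : 0 < complex.Im z) :
  [/\ Dfun s n z (Num.conj z) != 0,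
      arc_on_circle (w1 s n a b z) (m1 s n z) (r1 s n z) &
      indeterminate_moment_problem a b n s ->
        only_circle_through_arc (w1 s n a b z) (m1 s n z) (r1 s n z)]
  /\ ((0 < n)%N ->
      [/\ den2 s n a b z != 0,
          arc_on_circle (w2 s n a b z) (m2 s n a b z) (r2 s n a b z) &
          indeterminate_moment_problem a b n s ->
            only_circle_through_arc (w2 s n a b z) (m2 s n a b z) (r2 s n a b z)])
  /\ (n = 0%N -> den2 s n a b z = 0 /\ arc_on_line (w2 s n a b z)).
Proof.
have Im_z : complex.Im z != 0 by rewrite gt_eqF.
have [mu sol_mu] := hs; have nonneg_s := solution_nonneg sol_mu.
have Dab_neq0 := Dfun_endpoints_neq0 hab hpos.
split; [split | split].
- exact: Dfun_diag_neq0.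
- exact: w1_on_circle.
- by move=> /Dab_neq0; exact: w1_only_circle.
- move=> n_gt0; split.
  + exact: den2_neq0.
  + exact: w2_on_circle.
  + by move=> /Dab_neq0; exact: w2_only_circle.
- by move=> n0; move: hpos; rewrite n0; exact: degree0_line.
Qed.
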